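(* Let $n, r, s$ be integers with $r \geq 1$ and $s \geq 1$. Suppose that at least one of the following holds: (i) $(r+1)(s+2) \leq n$; or (ii) $s = p^2 r$ for some integer $p \geq 1$, and $(r+2)^{3/2} s^{1/2} \leq n$. Then the set $\mathrm{LS}_n(r,s)$ is not a closed subset of $\mathbb{R}^{n\times n}$.
   Context: For a matrix $S$, $\|S\|_0$ denotes the number of nonzero entries of $S$. For integers $n \ge 1$ and $r,s \ge 0$, the set of low-rank plus sparse matrices is $$\mathrm{LS}_n(r,s) = \{ L + S : L, S \in \mathbb{R}^{n\times n},\ \operatorname{rank}(L) \leq r,\ \|S\|_0 \leq s\}.$$ Closedness is with respect to the usual topology on $\mathbb{R}^{n\times n}$ (induced by the Frobenius norm). *)

(* Defs.v *)
From HB Require Import structures.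
From mathcomp Require Import all_boot all_order all_algebra.
From mathcomp Require Import all_classical all_reals all_analysis.

Set Implicit Arguments.
Unset Strict Implicit.
Unset Printing Implicit Defensive.

Import Order.TTheory GRing.Theory Num.Theory.
Import numFieldNormedType.Exports.

Local Open Scope classical_set_scope.
Local Open Scope ring_scope.

Definition mxnnz (R : realType) (m n : nat) (A : 'M[R]_(m, n)) : nat :=
  #|[pred ij : 'I_m * 'I_n | A ij.1 ij.2 != 0]|.

(* The canonical topology on 'M[R]_n is the entrywise (product) one; in this
   finite-dimensional space it is the topology of the Frobenius norm. *)
Definition LS (R : realType) (n r s : nat) : set 'M[R]_n :=
  [set M | exists L S : 'M[R]_n,
     [/\ (\rank L <= r)%N, (mxnnz S <= s)%N & M = L + S]].

Arguments LS R n r s : clear implicits.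

(* Main.v *)
Require Import Defs.
From HB Require Import structures.
From mathcomp Require Import all_boot all_order all_algebra.
From mathcomp Require Import all_classical all_reals all_analysis.
From mathcomp Require Import perm zify lra.

Set Implicit Arguments.
Unset Strict Implicit.
Unset Printing Implicit Defensive.

Import Order.TTheory GRing.Theory Num.Theory.
Import numFieldNormedType.Exports.

Local Open Scope classical_set_scope.
Local Open Scope ring_scope.

(* Split the indices into class 0 (the first k ones) and classes 1..r (the others,
   modulo r), and let M x y = 1 if the transposition (0 1) maps the class of y to
   that of x, and 0 otherwise.  With T_e = tperm_mx 0 1 + e E_11 + e^-1 E_00,
   which has proportional rows 0 and 1 and hence rank at most r, M is the limit
   as e -> 0 of the blow-up of T_e plus the blow-up of - e^-1 E_00, which has
   only k^2 <= s nonzero entries.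
   On the other hand, taking one index from class 0 and a block of r consecutive
   ones from the others gives (r+1)x(r+1) submatrices of M that are invertible
   whatever their corner entry.  If k <= N and r N + k <= n, then k N of them are
   disjoint outside the corners, so when k N > s some of them is untouched by any
   s-sparse S (up to its corner) and M - S has rank r+1.
   Condition (i) allows k = 1, N = s + 1 and condition (ii) k = p, N = p r + 1. *)

Lemma mxrank_mxsub_leq (F : fieldType) (m n m' n' : nat)
  (f : 'I_m' -> 'I_m) (g : 'I_n' -> 'I_n) (A : 'M[F]_(m, n)) :
  (\rank (mxsub f g A) <= \rank A)%N.
Proof.
have -> : mxsub f g A = rowsub f 1%:M *m A *m colsub g 1%:M.
  by rewrite -rowsubE mulmx_colsub mulmx1; apply/matrixP=> i j; rewrite !mxE.
by rewrite (leq_trans (mxrankM_maxl _ _)) ?mxrankM_maxr.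
Qed.

(** Columns other than column 0 are unit vectors and force a left kernel vector to vanish off index
    1. Column 0 has a 1 in row 1, and its free corner entry meets a coordinate already known to be
    0, so index 1 vanishes too. *)
Lemma mxrank_tperm_corner (F : fieldType) (q : nat) (B : 'M[F]_q.+2) :
  (forall i j, (i, j) != (0, 0) -> B i j = tperm_mx 0 1 i j) ->
  \rank B = q.+2.
Proof.
move=> hB; apply/eqP/inj_row_free=> v vB0.
have Bcol (i j : 'I_q.+2) : j != 0 -> B i j = (i == tperm 0 1 j)%:R.
  move=> j0; rewrite hB; last by rewrite xpair_eqE (negbTE j0) andbF.
  by rewrite !mxE (can2_eq (tpermK 0 1) (tpermK 0 1)).
have vtperm (j : 'I_q.+2) : j != 0 -> v 0 (tperm 0 1 j) = 0.
  move=> j0; move/matrixP/(_ 0 j): vB0; rewrite !mxE => s0; rewrite -[RHS]s0.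
  rewrite [RHS](bigD1 (tperm 0 1 j)) //= Bcol // eqxx mulr1 big1 ?addr0 // => i.
  by move=> /negbTE ij; rewrite Bcol // ij mulr0.
have v_neq1 (i : 'I_q.+2) : i != 1 -> v 0 i = 0.
  move=> i1; rewrite -(tpermK 0 1 i) vtperm //.
  by rewrite -(inj_eq (@perm_inj _ (tperm 0 1))) tpermK tpermL.
have v1 : v 0 1 = 0.
  move/matrixP/(_ 0 0): vB0; rewrite !mxE (bigD1 1) //= big1 => [|i i1].
    by rewrite addr0 hB // !mxE tpermR eqxx mulr1.
  by rewrite v_neq1 // mul0r.
apply/rowP=> i; rewrite !mxE; case: (eqVneq i 1) => [->//|]; exact: v_neq1.
Qed.

Lemma mxrank_tperm_deform (F : fieldType) (q : nat) (e : F) : e != 0 ->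
  (\rank (tperm_mx 0 1 + e *: delta_mx 1 1 + e^-1 *: delta_mx 0 0
          : 'M[F]_q.+2)%R <= q.+1)%N.
Proof.
move=> e0; set T := (_ + _)%R.
rewrite -ltnS ltn_neqAle rank_leq_row andbT; apply/negP => /row_free_inj Tinj.
(* Row 1 of [T] is [e] times row 0. *)
have : (delta_mx 0 1 - e *: delta_mx 0 0 : 'rV[F]_q.+2) = 0.
  apply: Tinj; rewrite mul0mx mulmxBl -scalemxAl -!rowE.
  apply/rowP=> j; rewrite !mxE tpermL tpermR !eqxx /=.
  rewrite ?(eq_sym 1 j) ?(eq_sym 0 j).
  case: (eqVneq j 0) => [->|_] /=.
    by rewrite !mulr0 !mulr1 !addr0 add0r mulfV ?subrr.
  by rewrite !mulr0 !addr0 add0r subrr.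
move/matrixP/(_ 0 1); rewrite !mxE !eqxx /= mulr0 subr0.
by move/eqP; rewrite oner_eq0.
Qed.

(** Pigeonhole: otherwise, choosing a nonzero entry of [S] in each of the disjoint regions [E t]
    would inject [T] into the support of [S]. *)
Lemma mxnnz_avoid (R : realType) (m n s : nat) (S : 'M[R]_(m, n))
  (T : finType) (E : T -> 'I_m -> 'I_n -> Prop) :
  (mxnnz S <= s)%N -> (s < #|T|)%N ->
  (forall t t' x y, E t x y -> E t' x y -> t = t') ->
  exists t, forall x y, E t x y -> S x y = 0.
Proof.
move=> nS sT Einj; apply: contrapT => nex.
have hit t : exists xy, E t xy.1 xy.2 /\ S xy.1 xy.2 != 0.
  apply: contrapT => nt; apply: nex; exists t => x y Exy.
  by apply/eqP/negPn/negP => Sxy; apply: nt; exists (x, y).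
have [h hP] := choice hit.
have hinj : injective h.
  move=> t t' htt'; apply: (Einj _ _ (h t).1 (h t).2).
    by case: (hP t).
  by rewrite htt'; case: (hP t').
suff: (#|T| <= mxnnz S)%N by rewrite leqNgt (leq_ltn_trans nS).
rewrite -(fintype.card_image hinj) subset_leq_card //; apply/fintype.subsetP=> xy.
by move=> /fintype.imageP[t _ ->]; rewrite inE; case: (hP t).
Qed.

(** Here [r = q.+1]; the value never exceeds [q.+1], so [inord] does not fall back to its
    default. *)
Definition coord_class (k q n : nat) (x : 'I_n) : 'I_q.+2 :=
  inord (if (x < k)%N then 0%N else ((x - k) %% q.+1).+1).

(* Representatives of the classes: [a] for class 0, and the [i]-th of the
   consecutive blocks of length [q.+1] starting at [k] for the others. *)
Definition coord_repr (k q m : nat) (a i : nat) (l : 'I_q.+2) : 'I_m.+1 :=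
  inord (if l == 0%R then a else k + i * q.+1 + l.-1)%N.

Lemma coord_class_eq0 (k q n : nat) (x : 'I_n) :
  (@coord_class k q n x == 0) = (x < k)%N.
Proof.
rewrite -val_eqE /coord_class /= inordK; first by case: ifP.
by case: ifP => // _; rewrite ltnS ltn_pmod.
Qed.

Lemma coord_repr_val (k q m N a i : nat) (l : 'I_q.+2) :
  (q.+1 * N + k <= m.+1)%N -> (a < k)%N -> (i < N)%N ->
  coord_repr k m a i l = (if l == 0%R then a else k + i * q.+1 + l.-1)%N :> nat.
Proof.
move=> hm ak iN; rewrite inordK //; case: ifP => [_|l0]; first by nia.
have := ltn_ord l; nia.
Qed.

Lemma coord_reprK (k q m N a i : nat) (l : 'I_q.+2) :
  (q.+1 * N + k <= m.+1)%N -> (a < k)%N -> (i < N)%N ->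
  coord_class k q (coord_repr k m a i l) = l.
Proof.
move=> hm ak iN; apply: val_inj; rewrite /coord_class.
rewrite (coord_repr_val l hm ak iN) /= inordK; last first.
  by case: ifP => // _; rewrite ltnS ltn_pmod.
case: (eqVneq l 0) => [->|l0]; first by rewrite ak.
have l1 : (0 < l)%N by rewrite lt0n.
rewrite -addnA ltnNge leq_addr /= addKn modnMDl modn_small ?prednK //.
by have := ltn_ord l; lia.
Qed.

Lemma coord_repr_div (k q m N a i : nat) (l : 'I_q.+2) :
  (q.+1 * N + k <= m.+1)%N -> (a < k)%N -> (i < N)%N -> l != 0 ->
  ((coord_repr k m a i l - k) %/ q.+1)%N = i.
Proof.
move=> hm ak iN l0; rewrite (coord_repr_val l hm ak iN) (negbTE l0).
have l1 : (0 < l)%N by rewrite lt0n.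
rewrite -addnA addKn divnMDl // divn_small ?addn0 //.
by have := ltn_ord l; lia.
Qed.

(* The submatrices indexed by [(a, j)] meet only in their corner entries;
   shifting the row block by [a] separates those that share a column block. *)
Lemma coord_repr_pair_inj (k q m N : nat) (t t' : 'I_k * 'I_N)
    (l1 l2 l1' l2' : 'I_q.+2) :
  (q.+1 * N + k <= m.+1)%N -> (k <= N)%N ->
  (l1, l2) != (0, 0) ->
  coord_repr k m t.1 ((t.2 + t.1) %% N) l1
    = coord_repr k m t'.1 ((t'.2 + t'.1) %% N) l1' ->
  coord_repr k m t.1 t.2 l2 = coord_repr k m t'.1 t'.2 l2' ->
  t = t'.
Proof.
case: t t' => [a j] [a' j'] /= hm kN l12 e1 e2.
have N0 : (0 < N)%N by rewrite (leq_ltn_trans _ (ltn_ord j)).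
have iN : ((j + a) %% N < N)%N by rewrite ltn_mod.
have iN' : ((j' + a') %% N < N)%N by rewrite ltn_mod.
have ak := ltn_ord a; have ak' := ltn_ord a'.
have jN := ltn_ord j; have jN' := ltn_ord j'.
have El1 : l1 = l1'.
  by rewrite -(coord_reprK l1 hm ak iN) e1 (coord_reprK l1' hm ak' iN').
have El2 : l2 = l2'.
  by rewrite -(coord_reprK l2 hm ak jN) e2 (coord_reprK l2' hm ak' jN').
subst l1' l2'.
have a1 : l1 = 0 -> a = a' :> nat.
  move=> z; move/(congr1 val): e1.
  by rewrite /= (coord_repr_val _ hm ak iN) (coord_repr_val _ hm ak' iN') z.
have a2 : l2 = 0 -> a = a' :> nat.
  move=> z; move/(congr1 val): e2.
  by rewrite /= (coord_repr_val _ hm ak jN) (coord_repr_val _ hm ak' jN') z.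
have i1 : l1 != 0 -> ((j + a) %% N = (j' + a') %% N)%N.
  move=> z; rewrite -(coord_repr_div hm ak iN z) e1.
  by rewrite (coord_repr_div hm ak' iN' z).
have i2 : l2 != 0 -> j = j' :> nat.
  move=> z; rewrite -(coord_repr_div hm ak jN z) e2.
  by rewrite (coord_repr_div hm ak' jN' z).
suff [ea ej] : a = a' :> nat /\ j = j' :> nat.
  by congr pair; apply: val_inj.
(* If exactly one class is 0, it yields [a = a'] and the other yields the block. If neither is 0,
   the column yields [j = j'], and then [a] and [a'], both below [k <= N], agree modulo [N]. *)
case: (eqVneq l1 0) l12 => [z1|z1]; case: (eqVneq l2 0) => [z2|z2].
- by rewrite z1 z2 eqxx.
- by split; [exact: a1|exact: i2].
- move=> _; split; first exact: a2.
  move/eqP: (i1 z1); rewrite (a2 z2) eqn_modDr.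
  by rewrite !modn_small // => /eqP.
- move=> _; split; last exact: i2.
  move/eqP: (i1 z1); rewrite (i2 z2) eqn_modDl.
  by rewrite !modn_small ?(leq_trans ak) ?(leq_trans ak') // => /eqP.
Qed.

Lemma card_ord_ltn_leq (n k : nat) : (#|[pred x : 'I_n | x < k]| <= k)%N.
Proof.
case: k => [|k]; first by rewrite (@eq_card0 _ _) // => x; rewrite !inE.
rewrite -{2}(card_ord k.+1) (@leq_card_in _ _ (fun x : 'I_n => inord x)) //.
move=> x y; rewrite !inE => xk yk /(congr1 val).
by rewrite /= !inordK // => /val_inj.
Qed.

Lemma LS_not_closed (R : realType) (n r s k N : nat) :
  (0 < r)%N -> (k <= N)%N -> (k ^ 2 <= s)%N -> (s < k * N)%N ->
  (r * N + k <= n)%N -> ~ closed (LS R n r s).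
Proof.
case: r => // q _; case: n => [|m]; first by nia.
move=> kN ks skN hm LScl.
pose cl := @coord_class k q m.+1.
pose M : 'M[R]_m.+1 := mxsub cl cl (tperm_mx 0 1).
pose W : 'M[R]_m.+1 := mxsub cl cl (delta_mx 1 1).
have : LS R m.+1 q.+1 s M.
  (* The parameter [e] runs through the harmonic sequence; [e *: W] is what remains once the [e^-1]
     terms cancel. *)
  apply: (@closed_cvg _ _ \oo _ (fun i => M + @harmonic R i *: W) _ LScl).
    apply: nearW => i; set e := harmonic i.
    have e0 : e != 0 by rewrite gt_eqF // /e harmonic_gt0.
    pose T : 'M[R]_q.+2 := (tperm_mx 0 1 + e *: delta_mx 1 1 + e^-1 *: delta_mx 0 0).
    exists (mxsub cl cl T), (mxsub cl cl (- e^-1 *: delta_mx 0 0)); split.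
    - by rewrite (leq_trans (mxrank_mxsub_leq _ _ _)) ?mxrank_tperm_deform.
    - apply: leq_trans ks; rewrite expnS expn1.
      apply: (@leq_trans (#|[pred x : 'I_m.+1 | (x < k)%N]|
                          * #|[pred x : 'I_m.+1 | (x < k)%N]|)%N).
        rewrite -cardX subset_leq_card //; apply/fintype.subsetP => -[x y].
        rewrite !inE /= !mxE /= -!(coord_class_eq0 k q).
        by rewrite mulf_eq0 negb_or pnatr_eq0 eqb0 negbK => /andP[_].
      by rewrite leq_mul // card_ord_ltn_leq.
    - apply/matrixP => x y; rewrite !mxE; lra.
  rewrite -[X in _ --> X]addr0 -[X in _ + X](scale0r W).
  apply: cvgD; first exact: cvg_cst.
  by apply: cvgZr_tmp; exact: cvg_harmonic.
case=> L [S [rL nS ME]].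
pose f (t : 'I_k * 'I_N) := @coord_repr k q m t.1 ((t.2 + t.1) %% N).
pose g (t : 'I_k * 'I_N) := @coord_repr k q m t.1 t.2.
pose E t x y := exists l1 l2, [/\ (l1, l2) != (0, 0), x = f t l1 & y = g t l2].
have [||t tS] := @mxnnz_avoid _ _ _ s S _ E nS.
- by rewrite card_prod !card_ord.
- move=> t t' x y [l1 [l2 [l12 -> ->]]] [l1' [l2' [_ e1 e2]]].
  exact: (coord_repr_pair_inj hm kN l12 e1 e2).
have := mxrank_mxsub_leq (f t) (g t) L.
(* Off its corner this submatrix of [L] equals [tperm_mx 0 1], so its rank [q.+2] contradicts
   [rL]. *)
rewrite mxrank_tperm_corner; first by rewrite leqNgt ltnS rL.
move=> i j ij.
have N0 : (0 < N)%N by rewrite (leq_ltn_trans _ (ltn_ord t.2)).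
have Kf l : cl (f t l) = l by apply: coord_reprK hm _ _; rewrite ?ltn_mod.
have Kg l : cl (g t l) = l by exact: coord_reprK hm _ _.
have -> : L = M - S by rewrite ME addrK.
rewrite mxE !mxE (tS (f t i) (g t j)) ?subr0 ?Kf ?Kg ?mxE //.
by exists i, j.
Qed.

Theorem theorem1p1 (R : realType) (n r s : nat)
  (hr : (1 <= r)%N) (hs : (1 <= s)%N)
  (hcond : ((r + 1) * (s + 2) <= n)%N \/
     ((exists p : nat, (1 <= p)%N /\ s = (p ^ 2 * r)%N) /\
      (r + 2)%:R `^ (3 / 2) * s%:R `^ (1 / 2) <= n%:R :> R)) :
  ~ closed (LS R n r s).
Proof.
case: hcond => [hn | [[p [p1 sE]] hn]].
  by apply: (@LS_not_closed R n r s 1 s.+1) => //; nia.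
(* Squaring removes the real powers. *)
have hn2 : ((r + 2) ^ 3 * s <= n ^ 2)%N.
  rewrite -(ler_nat R) natrM !natrX.
  have -> : (r + 2)%:R ^+ 3 * s%:R
      = ((r + 2)%:R `^ (3 / 2) * s%:R `^ (1 / 2)) ^+ 2 :> R.
    rewrite exprMn -!powR_mulrn ?powR_ge0 // -!powRrM.
    by rewrite !divfK ?pnatr_eq0 // powRr1.
  by rewrite lerXn2r ?nnegrE ?mulr_ge0 ?powR_ge0.
apply: (@LS_not_closed R n r s p (p * r + 1)) => //; [nia|nia|nia|].
rewrite -leq_sqr; apply: leq_trans hn2; rewrite sE.
(* This uses [r <= p * r]; after squaring, [p ^ 2] cancels and
   [(r * r + r + 1) ^ 2 <= (r + 2) ^ 3 * r] remains. *)
have : (r * (p * r + 1) + p <= p * (r * r + r + 1))%N by nia.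
rewrite -leq_sqr => /leq_trans; apply.
rewrite expnMn mulnCA leq_mul //.
by rewrite !expnS !expn0; nia.
Qed.
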